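(* Let $p,m\ge 1$ be integers, let $\rho\in[0,1)$, and let $\mathcal{J}\subset\mathbb{R}^{p\times(p+m)}$ be a nonempty compact set of matrices such that every $[A,B]\in\mathcal{J}$ (with $A\in\mathbb{R}^{p\times p}$, $B\in\mathbb{R}^{p\times m}$) satisfies $\|A\|_{\mathrm{op}}\le\rho$. For $\mathcal{X}\subset\mathbb{R}^{p\times m}$ put $$\mathcal{J}(\mathcal{X})=\{AX+B:\ [A,B]\in\mathcal{J},\ X\in\mathcal{X}\}.$$ Then there is a unique nonempty compact set $\mathrm{fix}(\mathcal{J})\subset\mathbb{R}^{p\times m}$ satisfying $\mathrm{fix}(\mathcal{J})=\mathcal{J}(\mathrm{fix}(\mathcal{J}))$. Moreover, let $(\mathcal{X}_k)_{k\in\mathbb{N}}$ be a sequence of compact subsets of $\mathbb{R}^{p\times m}$ with $\mathcal{X}_0\neq\emptyset$ and $\mathcal{X}_{k+1}=\mathcal{J}(\mathcal{X}_k)$ for all $k\in\mathbb{N}$. Then for all $k\in\mathbb{N}$, $$\mathrm{dist}(\mathcal{X}_k,\mathrm{fix}(\mathcal{J}))\le\rho^k\,\frac{\mathrm{dist}(\mathcal{X}_0,\mathcal{J}(\mathcal{X}_0))}{1-\rho}.$$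
   Context: $[A,B]$ denotes the concatenation of $A$ and $B$. $\|\cdot\|_{\mathrm{op}}$ is the operator norm induced by the Euclidean norm. For nonempty compact sets $\mathcal{X},\mathcal{Y}$, $\mathrm{gap}(\mathcal{X},\mathcal{Y})=\max_{x\in\mathcal{X}}\min_{y\in\mathcal{Y}}\|x-y\|$ and $\mathrm{dist}(\mathcal{X},\mathcal{Y})=\max(\mathrm{gap}(\mathcal{X},\mathcal{Y}),\mathrm{gap}(\mathcal{Y},\mathcal{X}))$ is the Hausdorff distance; here $\|\cdot\|$ is the Euclidean (Frobenius) norm on $p\times m$ matrices. *)

(* Defs.v *)
From HB Require Import structures.
From mathcomp Require Export all_boot all_order all_algebra.
From mathcomp Require Export boolp classical_sets reals.
From mathcomp Require Export topology normedtype.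
Export Order.TTheory GRing.Theory Num.Theory.
Export numFieldNormedType.Exports.

Set Implicit Arguments.
Unset Strict Implicit.
Unset Printing Implicit Defensive.

Local Open Scope classical_set_scope.
Local Open Scope ring_scope.

(* The library norm `|M| on matrices is the entrywise max norm, so the Euclidean
   norm is defined here. For column vectors (n = 1) it is the usual one.
   Both norms induce the library topology on matrices, so the library's
   [compact] is compactness for the Euclidean norm. *)
Definition fnorm (R : realType) (m n : nat) (M : 'M[R]_(m, n)) : R :=
  Num.sqrt (\sum_(i < m) \sum_(j < n) M i j ^+ 2).

(* The set is nonempty (v = 0) and bounded, so the supremum is a genuine one. *)
Definition opnorm (R : realType) (m n : nat) (A : 'M[R]_(m, n)) : R :=
  sup [set fnorm (A *m v) | v in [set v : 'cV[R]_n | fnorm v <= 1]].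

(* Meaningful for nonempty compact sets, on which the supremum and the infimum
   are attained, i.e. are the maximum and the minimum. *)
Definition gap (R : realType) (m n : nat) (X Y : set 'M[R]_(m, n)) : R :=
  sup [set inf [set fnorm (x - y) | y in Y] | x in X].

Definition hdist (R : realType) (m n : nat) (X Y : set 'M[R]_(m, n)) : R :=
  Num.max (gap X Y) (gap Y X).

Definition matset_map (R : realType) (p m : nat) (J : set 'M[R]_(p, p + m))
    (X : set 'M[R]_(p, m)) : set 'M[R]_(p, m) :=
  [set Y | exists A : 'M[R]_(p, p), exists B : 'M[R]_(p, m),
           exists x : 'M[R]_(p, m),
             [/\ J (row_mx A B), X x & Y = A *m x + B]].

Definition compact_fixpoint (R : realType) (p m : nat)
    (J : set 'M[R]_(p, p + m)) (F : set 'M[R]_(p, m)) : Prop :=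
  [/\ F !=set0, compact F & F = matset_map J F].

(* Main.v *)
(** The paper's set fix(J) is the limit of J^k(X) for the Hausdorff metric.
    Completeness of the space of compact sets is avoided here: the closed ball K
    of radius max |B| / (1 - rho) satisfies J(K) <= K, so the iterates J^n(K) are
    nested nonempty compact sets, and their intersection is a fixed point (for
    y in the intersection, the sets of pairs ([A,B], x) in J * J^n(K) with
    A x + B = y are again nested nonempty compact). Since J contracts the
    Hausdorff distance by rho, two fixed points are at distance 0, and
    dist(X, F) <= dist(X, J(X)) + rho dist(X, F) for every compact X. *)
From mathcomp Require Import ring lra.
From mathcomp Require Import derive realfun.
Require Import Defs.
Set Implicit Arguments.
Unset Strict Implicit.
Unset Printing Implicit Defensive.
Local Open Scope classical_set_scope.
Local Open Scope ring_scope.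

(** * Cauchy-Schwarz, and the Euclidean and operator norms of matrices *)

Lemma cauchy_schwarz_sum (R : realDomainType) (I : finType) (f g : I -> R) :
  (\sum_i f i * g i) ^+ 2 <= (\sum_i f i ^+ 2) * (\sum_i g i ^+ 2).
Proof.
set a := \sum_i f i ^+ 2; set b := \sum_i g i ^+ 2; set c := \sum_i f i * g i.
have b_ge0 : 0 <= b by apply: sumr_ge0 => i _; exact: sqr_ge0.
have [b0|b_neq0] := eqVneq b 0.
  suff -> : c = 0 by rewrite b0 mulr0 expr0n.
  have g0 i : g i = 0.
    apply/eqP; rewrite -sqrf_eq0; move/eqP: b0.
    rewrite psumr_eq0 => [/allP/(_ i)|j _]; last exact: sqr_ge0.
    by rewrite mem_index_enum => /(_ isT).
  by rewrite /c big1 // => i _; rewrite g0 mulr0.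
have b_gt0 : 0 < b by rewrite lt_def b_neq0.
(* These are the residuals of projecting [f] onto [g], scaled by [b] to avoid division. Their sum of
   squares is [b * (a * b - c ^+ 2)], and [b] is positive here. *)
have : 0 <= \sum_i (b * f i - c * g i) ^+ 2.
  by apply: sumr_ge0 => i _; exact: sqr_ge0.
have -> : \sum_i (b * f i - c * g i) ^+ 2 = b * (a * b - c ^+ 2).
  rewrite (eq_bigr (fun i => b ^+ 2 * f i ^+ 2 - 2 * b * c * (f i * g i)
                             + c ^+ 2 * g i ^+ 2)); last by move=> i _; ring.
  rewrite big_split sumrB /= -!mulr_sumr -/a -/b -/c; ring.
by rewrite pmulr_rge0 // subr_ge0.
Qed.

Section fnorm_theory.
Variable R : realType.

Lemma fnorm_ge0 m n (M : 'M[R]_(m, n)) : 0 <= fnorm M.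
Proof. exact: sqrtr_ge0. Qed.

Lemma sqr_fnorm m n (M : 'M[R]_(m, n)) :
  fnorm M ^+ 2 = \sum_i \sum_j M i j ^+ 2.
Proof.
by rewrite sqr_sqrtr //; do 2![apply: sumr_ge0 => ? _]; exact: sqr_ge0.
Qed.

Lemma fnorm0 m n : fnorm (0 : 'M[R]_(m, n)) = 0.
Proof.
apply/eqP; rewrite -sqrf_eq0 sqr_fnorm; apply/eqP.
by do 2![apply: big1 => ? _]; rewrite mxE expr0n.
Qed.

Lemma fnormZ m n a (M : 'M[R]_(m, n)) : fnorm (a *: M) = `|a| * fnorm M.
Proof.
apply/eqP; rewrite -(eqrXn2 (ltn0Sn 1)) ?mulr_ge0 ?fnorm_ge0 //.
rewrite exprMn !sqr_fnorm real_normK ?num_real // mulr_sumr; apply/eqP.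
apply: eq_bigr => i _; rewrite mulr_sumr; apply: eq_bigr => j _.
by rewrite mxE exprMn.
Qed.

Lemma fnormB m n (M N : 'M[R]_(m, n)) : fnorm (M - N) = fnorm (N - M).
Proof. by rewrite -opprB -scaleN1r fnormZ normrN1 mul1r. Qed.

(** Squaring reduces this to Cauchy-Schwarz for the entries, with each double sum flattened to a sum
    over index pairs. *)
Lemma ler_fnormD m n (M N : 'M[R]_(m, n)) : fnorm (M + N) <= fnorm M + fnorm N.
Proof.
rewrite -(@ler_pXn2r _ 2) ?nnegrE ?addr_ge0 ?fnorm_ge0 //.
have cs : \sum_i \sum_j M i j * N i j <= fnorm M * fnorm N.
  apply: le_trans (ler_norm _) _.
  rewrite -(@ler_pXn2r _ 2) ?nnegrE ?mulr_ge0 ?fnorm_ge0 //.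
  rewrite real_normK ?num_real // exprMn !sqr_fnorm !pair_bigA.
  exact: cauchy_schwarz_sum.
rewrite sqrrD !sqr_fnorm.
suff -> : \sum_i \sum_j (M + N) i j ^+ 2 = \sum_i \sum_j M i j ^+ 2
    + (\sum_i \sum_j M i j * N i j) *+ 2 + \sum_i \sum_j N i j ^+ 2.
  by rewrite lerD2r lerD2l lerMn2r cs orbT.
rewrite !pair_bigA -sumrMnl -!big_split /=.
by apply: eq_bigr => i _; rewrite mxE sqrrD.
Qed.

Lemma ler_fnorm_entry m n (M : 'M[R]_(m, n)) i j : `|M i j| <= fnorm M.
Proof.
rewrite -(@ler_pXn2r _ 2) ?nnegrE ?fnorm_ge0 // real_normK ?num_real //.
rewrite sqr_fnorm pair_bigA (bigD1 (i, j)) //= lerDl.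
by apply: sumr_ge0 => k _; exact: sqr_ge0.
Qed.

Lemma fnorm_le0_eq m n (M N : 'M[R]_(m, n)) : fnorm (M - N) <= 0 -> M = N.
Proof.
move=> MN; apply/matrixP => i j; apply/eqP; rewrite -subr_eq0 -normr_le0.
by have := ler_fnorm_entry (M - N) i j; rewrite !mxE => /le_trans; apply.
Qed.

Lemma sqr_fnorm_col m n (M : 'M[R]_(m, n)) :
  fnorm M ^+ 2 = \sum_j fnorm (col j M) ^+ 2.
Proof.
rewrite sqr_fnorm exchange_big; apply: eq_bigr => j _; rewrite sqr_fnorm.
by apply: eq_bigr => i _; rewrite big_ord1 mxE.
Qed.

(** Cauchy-Schwarz on each row of [A]. This bounds the set whose supremum is [opnorm A], so that its
    elements lie below that supremum. *)
Lemma ler_fnorm_mulmx_fnorm m n (A : 'M[R]_(m, n)) (v : 'cV[R]_n) :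
  fnorm (A *m v) <= fnorm A * fnorm v.
Proof.
rewrite -(@ler_pXn2r _ 2) ?nnegrE ?mulr_ge0 ?fnorm_ge0 // exprMn !sqr_fnorm.
rewrite mulr_suml; apply: ler_sum => i _; rewrite big_ord1 mxE.
apply: le_trans (cauchy_schwarz_sum _ _) _.
apply: ler_wpM2l; first by apply: sumr_ge0 => j _; exact: sqr_ge0.
by apply: ler_sum => j _; rewrite big_ord1.
Qed.

Lemma ler_opnorm_col m n (A : 'M[R]_(m, n)) (v : 'cV[R]_n) :
  fnorm (A *m v) <= opnorm A * fnorm v.
Proof.
(* For nonzero [fnorm v], the quotient is the value of [fnorm (A *m _)] at the unit vector obtained
   by rescaling [v]. *)
have [v0|v_neq0] := eqVneq (fnorm v) 0.
  by have := ler_fnorm_mulmx_fnorm A v; rewrite v0 !mulr0.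
have v_gt0 : 0 < fnorm v by rewrite lt_def v_neq0 fnorm_ge0.
rewrite -ler_pdivrMr //.
have -> : fnorm (A *m v) / fnorm v = fnorm (A *m ((fnorm v)^-1 *: v)).
  by rewrite -scalemxAr fnormZ ger0_norm ?invr_ge0 ?fnorm_ge0 // mulrC.
apply: ub_le_sup.
  exists (fnorm A) => _ [w /= w1 <-].
  by apply: le_trans (ler_fnorm_mulmx_fnorm _ _) _; rewrite ler_piMr ?fnorm_ge0.
exists ((fnorm v)^-1 *: v) => //=.
by rewrite fnormZ ger0_norm ?invr_ge0 ?fnorm_ge0 // mulVf.
Qed.

(** [A] acts on each column of [M] separately, and [fnorm M ^+ 2] is the sum of the squared column
    norms. *)
Lemma ler_opnorm_mulmx m n k (A : 'M[R]_(m, n)) (M : 'M[R]_(n, k)) rho :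
  opnorm A <= rho -> fnorm (A *m M) <= rho * fnorm M.
Proof.
(* For negative [rho], the bound [0 <= rho * fnorm (col j M)] makes every column vanish, so both
   sides are 0. *)
move=> A_rho; have [r_ge0|r_lt0] := leP 0 rho; last first.
  have Mcol j : fnorm (col j M) = 0.
    apply/eqP; rewrite eq_le fnorm_ge0 andbT -(nmulr_rge0 _ r_lt0).
    apply: le_trans (ler_wpM2r (fnorm_ge0 _) A_rho).
    exact: le_trans (fnorm_ge0 _) (ler_opnorm_col _ _).
  have /eqP : fnorm M ^+ 2 = 0.
    by rewrite sqr_fnorm_col big1 // => j _; rewrite Mcol expr0n.
  rewrite sqrf_eq0 => /eqP M0; rewrite M0 mulr0.
  have -> : M = 0 by apply: fnorm_le0_eq; rewrite subr0 M0.
  by rewrite mulmx0 fnorm0.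
rewrite -(@ler_pXn2r _ 2) ?nnegrE ?mulr_ge0 ?fnorm_ge0 //.
rewrite exprMn !sqr_fnorm_col mulr_sumr; apply: ler_sum => j _.
rewrite -exprMn ler_pXn2r ?nnegrE ?mulr_ge0 ?fnorm_ge0 //.
rewrite colE -mulmxA -colE; apply: le_trans (ler_opnorm_col _ _) _.
by rewrite ler_wpM2r ?fnorm_ge0.
Qed.

End fnorm_theory.

(** * Continuity and compactness for matrices *)

Section topology.
Variable R : realType.

Lemma continuous_mx (T S : topologicalType) m n (f : T -> 'M[S]_(m, n)) :
  (forall i j, continuous (fun x => f x i j)) -> continuous f.
Proof.
move=> f_cont x A [P fP PA].
apply: filterS (_ : nbhs x [set y | forall i j, P i j (f y i j)]).
  by move=> y Py; exact: PA.
do 2![apply: filter_forall => ?]; exact: f_cont (fP _ _).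
Qed.

Lemma continuous_sumr (T : topologicalType) (I : finType) (f : I -> T -> R) :
  (forall i, continuous (f i)) -> continuous (fun x => \sum_i f i x).
Proof.
move=> f_cont x; apply: cvg_big => [|i _]; last exact: f_cont.
exact: (@add_continuous R^o).
Qed.

Lemma continuous_fnorm m n : continuous (@fnorm R m n).
Proof.
have c : continuous (fun M : 'M[R]_(m, n) => \sum_i \sum_j M i j ^+ 2).
  do 2![apply: continuous_sumr => ?].
  move=> M; apply: (@continuous_comp _ _ _ _ (fun x : R => x ^+ 2)).
    exact: coord_continuous.
  exact: exprn_continuous.
move=> M; apply: (@continuous_comp _ _ _ _ Num.sqrt); first exact: c.
exact: sqrt_continuous.
Qed.

(** The ball is a closed subset of the cube of entries in [[- r, r]], which is compact as the
    continuous image of a product of segments. *)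
Lemma compact_fnorm_ball m n (r : R) :
  compact [set M : 'M[R]_(m, n) | fnorm M <= r].
Proof.
pose box := [set v : 'rV[R]_(m * n) | forall i, `[- r, r]%classic (v ord0 i)].
have cbox : compact box.
  apply: (@rV_compact _ _ (fun=> `[- r, r]%classic)) => i.
  exact: segment_compact.
apply: (@subclosed_compact _ _ (vec_mx @` box)).
- apply: (@closed_comp _ _ (@fnorm R m n) [set x | x <= r]).
    by move=> M _; exact: continuous_fnorm.
  exact: closed_le.
- apply: continuous_compact cbox; apply: continuous_subspaceT.
  apply: continuous_mx => i j.
  rewrite (_ : (fun x => _) = fun v : 'rV[R]_(m * n) => v 0 (mxvec_index i j)).
    exact: coord_continuous.
  by apply/funext => v; rewrite mxE.
- move=> M Mr; exists (mxvec M); last exact: mxvecK.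
  move=> k /=; case/mxvec_indexP: k => i j; rewrite mxvecE in_itv /= -ler_norml.
  exact: le_trans (ler_fnorm_entry _ _ _) Mr.
Qed.

(** The sets [K n] generate a proper filter. Compactness of [K 0] gives it a cluster point, which
    lies in every [K n] because these are closed. *)
Lemma nested_compact_neq0 (T : topologicalType) (K : nat -> set T) :
  hausdorff_space T -> (forall n, compact (K n)) -> (forall n, K n !=set0) ->
  (forall n, K n.+1 `<=` K n) -> \bigcap_n K n !=set0.
Proof.
move=> hT cK K0 Kdec.
have Kle a b : (a <= b)%N -> K b `<=` K a.
  move=> /subnK <-; elim: (b - a)%N => // k ih; apply: subset_trans ih.
  by rewrite addSn; exact: Kdec.
have FF : ProperFilter (filter_from setT K).
  apply: filter_from_proper => [|n _]; last exact: K0.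
  apply: filter_from_filter; first by exists 0%N.
  move=> a b _ _; exists (maxn a b) => // x Kx.
  by split; apply: Kle Kx; rewrite ?leq_maxl ?leq_maxr.
have [|x [_]] := cK 0%N _ FF; first by exists 0%N.
rewrite clusterE => cx; exists x => n _.
by have := compact_closed hT (cK n); rewrite closure_id => ->; apply: cx; exists n.
Qed.

End topology.

(** * Hausdorff distance through one-sided approximation *)

Section gap_theory.
Variables (R : realType) (m n : nat).
Implicit Types X Y Z : set 'M[R]_(m, n).

(** For nonempty compact sets this amounts to [gap X Y <= e]. Explicit witnesses let estimates be
    composed without handling [sup] and [inf]. *)
Definition near_set X Y (e : R) :=
  forall x, X x -> exists2 y, Y y & fnorm (x - y) <= e.

Lemma near_set_trans X Y Z a b :
  near_set X Y a -> near_set Y Z b -> near_set X Z (a + b).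
Proof.
move=> XY YZ x /XY[y /YZ[z Zz yz] xy]; exists z => //.
rewrite (_ : x - z = (x - y) + (y - z)); last by rewrite addrA subrK.
exact: le_trans (ler_fnormD _ _) (lerD xy yz).
Qed.

Lemma near_setW X Y a b : a <= b -> near_set X Y a -> near_set X Y b.
Proof. by move=> ab XY x /XY[y Yy /le_trans]; exists y => //; auto. Qed.

Lemma has_lbound_fnorm x Y : has_lbound [set fnorm (x - y) | y in Y].
Proof. by exists 0 => _ [y _ <-]; exact: fnorm_ge0. Qed.

Lemma gap_le X Y e : X !=set0 -> near_set X Y e -> gap X Y <= e.
Proof.
move=> X0 XY; apply: ge_sup; first exact: image_nonempty.
move=> _ [x /XY[y Yy xy] <-]; apply: le_trans xy.
by apply: ge_inf; [exact: has_lbound_fnorm | exists y].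
Qed.

Lemma near_set_gap X Y :
  compact X -> compact Y -> Y !=set0 -> near_set X Y (gap X Y).
Proof.
move=> cX cY Y0 x Xx.
have cdist (z : 'M[R]_(m, n)) : continuous (fun y : 'M[R]_(m, n) => fnorm (z - y)).
  move=> y; apply: (@continuous_comp _ _ _ (fun y : 'M[R]_(m, n) => z - y) (@fnorm R m n)).
    by apply: continuousB; [exact: cst_continuous | exact: cvg_id].
  exact: continuous_fnorm.
have [y Yy ymin] := compact_EVT_min Y0 cY (continuous_subspaceT (cdist x)).
have {}Yy := set_mem Yy.
exists y => //; apply: (@le_trans _ _ (inf [set fnorm (x - y) | y in Y])).
  apply: lb_le_inf; first exact: image_nonempty.
  by move=> _ [z /mem_set Yz <-]; exact: ymin.
(* The supremum must be shown to be over a bounded set: each infimum is at most the distance to the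
   single point [y], which has a maximum on the compact [X]. *)
apply: ub_le_sup; last by exists x.
have [z _ zmax] := compact_EVT_max (ex_intro _ x Xx) cX
  (continuous_subspaceT (cdist y)).
exists (fnorm (y - z)) => _ [w Xw <-].
apply: (@le_trans _ _ (fnorm (w - y))).
  by apply: ge_inf; [exact: has_lbound_fnorm | exists y].
by rewrite fnormB; apply: zmax; exact: mem_set.
Qed.

Lemma hdist_le X Y e : X !=set0 -> Y !=set0 ->
  near_set X Y e -> near_set Y X e -> hdist X Y <= e.
Proof. by move=> X0 Y0 XY YX; rewrite ge_max !gap_le. Qed.

Lemma near_set_hdist X Y : compact X -> compact Y -> X !=set0 -> Y !=set0 ->
  near_set X Y (hdist X Y) /\ near_set Y X (hdist X Y).
Proof.
move=> cX cY X0 Y0; split.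
  by apply: near_setW (near_set_gap cX cY Y0); rewrite le_max lexx.
by apply: near_setW (near_set_gap cY cX X0); rewrite le_max lexx orbT.
Qed.

Lemma near_set_sub X Y e : e <= 0 -> near_set X Y e -> X `<=` Y.
Proof. by move=> e0 XY x /XY[y Yy /le_trans/(_ e0)/fnorm_le0_eq ->]. Qed.

End gap_theory.

(** * The set map as a contraction, its fixed point and its iterates *)

Section matset_map_theory.
Variables (R : realType) (p m : nat) (rho : R) (J : set 'M[R]_(p, p + m)).
Hypotheses (rho_ge0 : 0 <= rho) (rho_lt1 : rho < 1).
Hypotheses (J_neq0 : J !=set0) (J_compact : compact J).
Hypothesis J_opnorm : forall (A : 'M[R]_(p, p)) (B : 'M[R]_(p, m)),
  J (row_mx A B) -> opnorm A <= rho.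
Implicit Types X Y F G : set 'M[R]_(p, m).

(** As one continuous map on pairs [([A,B], x)], it makes [matset_map J X] the image of a product,
    open to compactness arguments. *)
Definition affine_eval (z : 'M[R]_(p, p + m) * 'M[R]_(p, m)) : 'M[R]_(p, m) :=
  lsubmx z.1 *m z.2 + rsubmx z.1.

Lemma matset_mapE X : matset_map J X = affine_eval @` (J `*` X).
Proof.
apply/seteqP; split=> [_ [A [B [x [JAB Xx ->]]]]|_ [[M x] [/= JM Xx] <-]].
  by exists (row_mx A B, x); rewrite // /affine_eval row_mxKl row_mxKr.
by exists (lsubmx M), (rsubmx M), x; rewrite hsubmxK.
Qed.

Lemma continuous_affine_eval : continuous affine_eval.
Proof.
apply: continuous_mx => i j.
rewrite (_ : (fun z => _) = fun z : 'M[R]_(p, p + m) * 'M[R]_(p, m) =>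
   \sum_k z.1 i (lshift m k) * z.2 k j + z.1 i (rshift p j)); last first.
  apply/funext => z; rewrite !mxE; congr (_ + _).
  by apply: eq_bigr => k _; rewrite !mxE.
have c1 a b : continuous (fun z : 'M[R]_(p, p + m) * 'M[R]_(p, m) => z.1 a b).
  move=> z; apply: (@continuous_comp _ _ _ fst (fun M : 'M[R]_(p, p + m) => M a b)).
    exact: cvg_fst.
  exact: coord_continuous.
have c2 a b : continuous (fun z : 'M[R]_(p, p + m) * 'M[R]_(p, m) => z.2 a b).
  move=> z; apply: (@continuous_comp _ _ _ snd (fun M : 'M[R]_(p, m) => M a b)).
    exact: cvg_snd.
  exact: coord_continuous.
move=> z; apply: continuousD; last exact: c1.
apply: continuous_sumr => k w; apply: continuousM; [exact: c1 | exact: c2].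
Qed.

Lemma matset_map_compact X : compact X -> compact (matset_map J X).
Proof.
move=> cX; rewrite matset_mapE; apply: continuous_compact.
  exact/continuous_subspaceT/continuous_affine_eval.
exact: compact_setX.
Qed.

Lemma matset_map_neq0 X : X !=set0 -> matset_map J X !=set0.
Proof.
move=> [x Xx]; have [M JM] := J_neq0; rewrite matset_mapE.
by exists (affine_eval (M, x)), (M, x).
Qed.

Lemma matset_map_sub X Y : X `<=` Y -> matset_map J X `<=` matset_map J Y.
Proof. by move=> XY _ [A [B [x [? /XY ? ->]]]]; exists A, B, x. Qed.

(** Using the same [[A,B]] for [x] and for its approximant [y] cancels [B] and leaves
    [A *m (x - y)]. *)
Lemma near_set_matset_map X Y e :
  near_set X Y e -> near_set (matset_map J X) (matset_map J Y) (rho * e).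
Proof.
move=> XY _ [A [B [x [JAB /XY[y Yy xy] ->]]]].
exists (A *m y + B); first by exists A, B, y.
rewrite opprD addrACA subrr addr0 -mulmxBr.
apply: le_trans (ler_opnorm_mulmx _ (J_opnorm JAB)) _.
by rewrite ler_wpM2l.
Qed.

(** One inclusion suffices for uniqueness, by symmetry. Contraction forces [hdist F G <= 0], so each
    point of [F] coincides with its approximant in [G]. *)
Lemma compact_fixpoint_sub F G :
  compact_fixpoint J F -> compact_fixpoint J G -> F `<=` G.
Proof.
move=> [F0 cF FE] [G0 cG GE].
have [FG GF] := near_set_hdist cF cG F0 G0.
have : hdist F G <= rho * hdist F G.
  by apply: hdist_le => //; rewrite {1}FE {1}GE; apply: near_set_matset_map.
move=> h; apply: near_set_sub FG.
have lt0 : 0 < 1 - rho by rewrite subr_gt0.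
by rewrite -(pmulr_rle0 _ lt0) mulrBl mul1r subr_le0.
Qed.

Lemma exists_invariant_ball :
  exists2 r, 0 <= r & matset_map J [set M | fnorm M <= r] `<=` [set M | fnorm M <= r].
Proof.
have crs : continuous (fun M : 'M[R]_(p, p + m) => fnorm (rsubmx M)).
  move=> M; apply: (@continuous_comp _ _ _ rsubmx (@fnorm R p m)); last first.
    exact: continuous_fnorm.
  move: M; apply: continuous_mx => i j.
  rewrite (_ : (fun x => _) = fun M : 'M[R]_(p, p + m) => M i (rshift p j)).
    exact: coord_continuous.
  by apply/funext => M; rewrite mxE.
have [M0 _ M0max] := compact_EVT_max J_neq0 J_compact (continuous_subspaceT crs).
set b := fnorm (rsubmx M0) in M0max.
have lt0 : 0 < 1 - rho by rewrite subr_gt0.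
(* This radius solves [rho * r + b = r], where [b] is the largest norm of a block [B] over [J]. *)
exists (b / (1 - rho)); first by rewrite divr_ge0 ?fnorm_ge0 ?ltW.
move=> _ [A [B [x [JAB /= xr ->]]]].
apply: le_trans (ler_fnormD _ _) _.
have := M0max _ (mem_set JAB); rewrite row_mxKr => Bb.
apply: le_trans (lerD (ler_opnorm_mulmx _ (J_opnorm JAB)) Bb) _.
have rE : rho * (b / (1 - rho)) + b = b / (1 - rho) by field; lra.
by rewrite -[leRHS]rE lerD2r ler_wpM2l.
Qed.

Lemma exists_compact_fixpoint : exists F, compact_fixpoint J F.
Proof.
have [r r_ge0 rJ] := exists_invariant_ball.
pose K n := iter n (matset_map J) [set M | fnorm M <= r].
have cK n : compact (K n).
  elim: n => [|n ih]; [exact: compact_fnorm_ball | exact: matset_map_compact].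
have K_neq0 n : K n !=set0.
  elim: n => [|n ih]; last exact: matset_map_neq0.
  by exists 0; rewrite /= fnorm0.
(* The base case is the invariance [rJ] of the ball; monotonicity of the set map propagates it. *)
have Kdec n : K n.+1 `<=` K n.
  by elim: n => [|n ih] //; exact: matset_map_sub.
have hM : hausdorff_space 'M[R]_(p, m) by exact: norm_hausdorff.
exists (\bigcap_n K n); split.
- exact: nested_compact_neq0.
- apply: subclosed_compact (cK 0%N) _; last by move=> x /(_ 0%N I).
  by apply: closed_bigI => n _; exact: compact_closed.
- apply/seteqP; split=> [y Ky|y Fy n _]; last first.
    by apply: Kdec; apply: matset_map_sub Fy => x /(_ n I).
  (* Each [n] supplies its own pair sent to [y]. A common point of the nested sets [C n] is a single
     pair that serves all [n]. *)
  pose C n := (J `*` K n) `&` affine_eval @^-1` [set y].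
  have [|n|n|n|[M x] Cz] := @nested_compact_neq0 _ C.
  + exact: norm_hausdorff.
  + apply: compact_closedI; first exact: compact_setX.
    apply: closed_comp => [z _|]; first exact: continuous_affine_eval.
    exact/accessible_closed_set1/hausdorff_accessible.
  (* The index shifts by one: membership of [y] in [K n.+1] gives a preimage with second component
     in [K n]. *)
  + have := Ky n.+1 I; rewrite /K iterS matset_mapE => -[z Jz zy].
    by exists z.
  + by move=> z [[Jz /Kdec Kz] zy].
  + have [[/= JM _] zy] := Cz 0%N I.
    rewrite matset_mapE; exists (M, x) => //; split=> //= n _.
    by have [[]] := Cz n I.
Qed.

Lemma hdist_iterates_le F (X : nat -> set 'M[R]_(p, m)) : compact_fixpoint J F ->
  (forall k, compact (X k)) -> X 0%N !=set0 ->
  (forall k, X k.+1 = matset_map J (X k)) ->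
  forall k, hdist (X k) F <=
    rho ^+ k * (hdist (X 0%N) (matset_map J (X 0%N)) / (1 - rho)).
Proof.
move=> [F0 cF FE] cX X0 XE.
have Xneq0 k : X k !=set0.
  by elim: k => [//|k ih]; rewrite XE; exact: matset_map_neq0.
set d := hdist (X 0%N) _; set e := d / (1 - rho).
have lt0 : 0 < 1 - rho by rewrite subr_gt0.
have [XF FX] := near_set_hdist (cX 0%N) cF X0 F0.
have [XJ JX] : near_set (X 0%N) (matset_map J (X 0%N)) d /\
    near_set (matset_map J (X 0%N)) (X 0%N) d.
  by apply: near_set_hdist; rewrite -?XE.
have h0 : hdist (X 0%N) F <= e.
  (* The intermediate set is [matset_map J (X 0)]: it is within [d] of [X 0], and contraction
     compares it with [F], its own image. Solving for the distance produces the factor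
     [1 / (1 - rho)]. *)
  have : hdist (X 0%N) F <= d + rho * hdist (X 0%N) F.
    apply: hdist_le => //.
      rewrite {1}FE; apply: near_set_trans XJ _; exact: near_set_matset_map.
    rewrite addrC {1}FE; apply: near_set_trans JX; exact: near_set_matset_map.
  by rewrite ler_pdivlMr //; lra.
(* Both directions are carried through the induction, since contraction is available for [near_set];
   each step replaces [X k] and [F] by their images and gains a factor [rho]. *)
have near k : near_set (X k) F (rho ^+ k * e) /\ near_set F (X k) (rho ^+ k * e).
  elim: k => [|k [XkF FXk]].
    by rewrite expr0 mul1r; split; apply: near_setW h0 _.
  by rewrite exprS -mulrA XE FE; split; exact: near_set_matset_map.
by move=> k; have [? ?] := near k; exact: hdist_le.
Qed.

End matset_map_theory.

Theorem theorem1 (R : realType) (p m : nat) (rho : R) (J : set 'M[R]_(p, p + m))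
  (p_ge1 : (1 <= p)%N) (m_ge1 : (1 <= m)%N)
  (rho_ge0 : 0 <= rho) (rho_lt1 : rho < 1)
  (J_neq0 : J !=set0) (J_compact : compact J)
  (J_opnorm : forall (A : 'M[R]_(p, p)) (B : 'M[R]_(p, m)),
     J (row_mx A B) -> opnorm A <= rho) :
  (exists! F : set 'M[R]_(p, m), compact_fixpoint J F) /\
  (forall F : set 'M[R]_(p, m), compact_fixpoint J F ->
   forall X : nat -> set 'M[R]_(p, m),
     (forall k : nat, compact (X k)) ->
     X 0%N !=set0 ->
     (forall k : nat, X k.+1 = matset_map J (X k)) ->
     forall k : nat,
       hdist (X k) F <= rho ^+ k * (hdist (X 0%N) (matset_map J (X 0%N)) / (1 - rho))).
Proof.
split; last by move=> F fixF X cX X0 XE; exact: hdist_iterates_le.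
have [F fixF] := exists_compact_fixpoint rho_ge0 rho_lt1 J_neq0 J_compact J_opnorm.
exists F; split=> // G fixG.
by apply/seteqP; split; apply: compact_fixpoint_sub; eassumption.
Qed.
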